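(* Let $n \ge 2$ and let $A_L$, $A_R$ be the matrices of the $n$-dimensional border-collision normal form. Suppose $\alpha > 1$ is an eigenvalue of $A_L$ with multiplicity one, $-\beta < -1$ is an eigenvalue of $A_R$ with multiplicity one, and all other eigenvalues of $A_L$ and $A_R$ have modulus at most $r$, where $0 < r < 1$. Let $\Psi$ be the cone defined in the context. If $$r(n-1) < \frac{3}{7}\left(1 - \frac{1}{\alpha}\right), \qquad r(n-1) < \frac{3}{7}\left(1 - \frac{1}{\beta}\right), \qquad r(n-1) < \frac{1}{10}\left(\frac{1}{\alpha} + \frac{1}{\beta} - 1\right),$$ then $\Psi$ is contracting-invariant and expanding for $\{A_L, A_R\}$.
   Context: Given an integer $n \ge 2$ and real parameters $a^L_1,\ldots,a^L_n,a^R_1,\ldots,a^R_n$, for each $Z \in \{L,R\}$ let $A_Z$ be the real $n \times n$ matrix whose first column is $(-a^Z_1,\ldots,-a^Z_n)^{\sf T}$, whose $(i,i+1)$ entries equal $1$ for $i = 1,\ldots,n-1$, and all of whose other entries are $0$. For $i = 1,\ldots,n-1$ let $N_i = \frac{\min[\alpha,\beta] - 1}{2}\binom{n-1}{i-1}$, and let $$\Psi = \left\{ \gamma\,(1, m_1, m_2, \ldots, m_{n-1})^{\sf T} : \gamma \in \mathbb{R},\ |m_i| \le N_i r^{i-1} \text{ for all } i = 1,\ldots,n-1 \right\}.$$ For a collection $\mathcal{U}$ of real $n \times n$ matrices, a cone $\Psi \subset \mathbb{R}^n$ is contracting-invariant if $A v \in \mathrm{int}(\Psi) \cup \{\mathbf{0}\}$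 for all $A \in \mathcal{U}$ and $v \in \Psi$; it is expanding if there exists $c > 1$ such that $\|A v\| \ge c\|v\|$ for all $A \in \mathcal{U}$ and $v \in \Psi$, where $\|\cdot\|$ is the Euclidean norm. *)

(* Defs.v *)
From HB Require Import structures.
From mathcomp Require Import all_boot all_order all_algebra.
From mathcomp Require Import complex.
From mathcomp Require Import mathcomp_extra boolp classical_sets reals.
From mathcomp Require Import topology normedtype.

Set Implicit Arguments.
Unset Strict Implicit.
Unset Printing Implicit Defensive.

Import Order.TTheory GRing.Theory Num.Theory.
Import numFieldNormedType.Exports.

Local Open Scope classical_set_scope.
Local Open Scope ring_scope.
Local Open Scope complex_scope.

Section Definitions.
Variable R : realType.

(* Indices are 0-based here: a i is the coefficient usually written a_(i+1). *)
Definition bcnf_matrix (n : nat) (a : 'I_n -> R) : 'M[R]_n :=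
  \matrix_(i < n, j < n)
    if (j == 0 :> nat)%N then - a i
    else if (j == i.+1 :> nat)%N then 1 else 0.

Definition complexify (n : nat) (A : 'M[R]_n) : 'M[R[i]]_n :=
  map_mx (real_complex R) A.

(* Algebraic multiplicity; MathComp's [eigenvalue] is phrased with row vectors,
   which gives the same spectrum as column vectors. *)
Definition simple_eigenvalue (n : nat) (A : 'M[R]_n) (z : R[i]) : Prop :=
  eigenvalue (complexify A) z /\ mup z (char_poly (complexify A)) = 1%N.

(* The eigenvalue z0 is excluded as a value, so this says "all other
   eigenvalues" when z0 is a simple eigenvalue. *)
Definition other_eigenvalues_le (n : nat) (A : 'M[R]_n) (z0 : R[i]) (r : R) :
    Prop :=
  forall z : R[i], eigenvalue (complexify A) z -> z != z0 -> `|z| <= r%:C.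

Definition coneN (n : nat) (alpha beta : R) (i : nat) : R :=
  (Num.min alpha beta - 1) / 2 * 'C(n.-1, i.-1)%:R.

(* The m_i keep their indices 1, ..., n-1; m 0 and m i for i >= n are unused. *)
Definition conePsi (n : nat) (alpha beta r : R) : set 'cV[R]_n :=
  [set v | exists (gamma : R) (m : nat -> R),
      (forall i : nat, (1 <= i <= n.-1)%N ->
         `|m i| <= coneN n alpha beta i * r ^+ i.-1) /\
      v = gamma *: \col_(i < n) (if (i == 0 :> nat)%N then 1 else m i)].

Definition eucl_norm (n : nat) (v : 'cV[R]_n) : R :=
  Num.sqrt (\sum_(i < n) v i 0 ^+ 2).

Definition contracting_invariant (n : nat) (U : set 'M[R]_n)
    (Psi : set 'cV[R]_n) : Prop :=
  forall A v, U A -> Psi v -> (interior Psi `|` [set 0]) (A *m v).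

Definition expanding (n : nat) (U : set 'M[R]_n) (Psi : set 'cV[R]_n) : Prop :=
  exists2 c : R, 1 < c &
    forall A v, U A -> Psi v -> c * eucl_norm v <= eucl_norm (A *m v).

Lemma conePsi_scale (n : nat) (alpha beta r t : R) (v : 'cV[R]_n) :
  conePsi alpha beta r v -> conePsi alpha beta r (t *: v).
Proof.
by move=> [gamma [m [hm ->]]]; exists (t * gamma), m; rewrite scalerA.
Qed.

End Definitions.

(* Main.v *)
(* The characteristic polynomial of A_Z is (X - l) q(X) with |l| the large
   eigenvalue and q having all its roots in the disc of radius r, so the
   coefficient of X^(m-k) in q, m = n-1, is at most 'C(m, k) r^k in modulus.
   Since a_i is a difference e_i - l e_(i-1) of such coefficients, the image
   of (1, m_1, ..., m_(n-1)) has a first entry at least nu - x - d and an i-th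
   further entry of order r^i, where nu = min(alpha, beta), d = (nu - 1) / 2
   and x = r (n-1). Both claims then reduce to two polynomial inequalities in
   nu and x; for the expansion, vectors of the cone with first entry 1 have
   squared norm at most 1 + d^2 (1 + x^2 + x^4 + ...). *)

Require Import Defs.
From HB Require Import structures.
From mathcomp Require Import all_boot all_order all_algebra.
From mathcomp Require Import complex.
From mathcomp Require Import mathcomp_extra boolp classical_sets reals.
From mathcomp Require Import topology normedtype.
From mathcomp Require Import perm ring lra zify.

Set Implicit Arguments.
Unset Strict Implicit.
Unset Printing Implicit Defensive.

Import Order.TTheory GRing.Theory Num.Theory.
Import numFieldNormedType.Exports.

Local Open Scope classical_set_scope.
Local Open Scope ring_scope.
Local Open Scope complex_scope.

(** * Characteristic polynomial of the normal form *)

(** The two signs of [s] cancel; applied below to the reversal of indices. *)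
Lemma det_mxsub_perm (R : comNzRingType) (n : nat) (s : 'S_n) (A : 'M[R]_n) :
  \det (row_perm s (col_perm s A)) = \det A.
Proof.
rewrite row_permE col_permE !det_mulmx !det_perm odd_permV [\det A * _]mulrC.
by rewrite signrMK.
Qed.

(* The hypothesis on A says that, after reversing the indices, A is the
   transpose of the companion matrix of p; the equation on n is kept separate
   to avoid casts. *)
Lemma char_poly_rev_tr_companion (R : comNzRingType) (n : nat) (A : 'M[R]_n)
    (p : {poly R}) :
  p \is monic -> n = (size p).-1 ->
  (forall i j : 'I_n, A i j =
     if (j == 0 :> nat)%N then - p`_(n.-1 - i) else (j == i.+1 :> nat)%:R) ->
  char_poly A = p.
Proof.
move=> pm en; subst n => hA.
rewrite -[RHS](companionmxK pm) /char_poly -[RHS]det_tr.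
rewrite -[RHS](det_mxsub_perm (perm (@rev_ord_inj _))); congr (\det _).
apply/matrixP => i j; rewrite !mxE !permE /= (inj_eq rev_ord_inj) eq_sym.
congr (_ - (_)%:P); rewrite hA.
have hi := ltn_ord i; have hj := ltn_ord j.
have -> : (((size p).-1 - j.+1)%N == (size p).-1.-1) = (j == 0 :> nat)%N by lia.
case: ifP => hj0; first by rewrite -subn1 -subnDA add1n.
have -> // : (((size p).-1 - j.+1).+1 == (size p).-1 - i.+1)%N = (j == i.+1 :> nat).
by move: hi hj hj0; case: (i) => i' /= _; case: (j) => j' /= _; lia.
Qed.

Lemma char_poly_bcnf (R : realType) (m : nat) (a : 'I_m.+1 -> R) :
  char_poly (bcnf_matrix a) =
  'X^(m.+1) + \poly_(k < m.+1) a (inord (m - k)).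
Proof.
have hs : (size (\poly_(k < m.+1) a (inord (m - k))) < size ('X^(m.+1) : {poly R}))%N.
  by rewrite size_polyXn ltnS size_poly.
apply: char_poly_rev_tr_companion.
- by rewrite monicE lead_coefDl // lead_coefXn.
- by rewrite size_polyDl // size_polyXn.
move=> i j; rewrite mxE; case: ifP => _; last by case: ifP.
have hi := ltn_ord i.
rewrite coefD coefXn coef_poly /= [_ == _](_ : _ = false); last by lia.
rewrite ifT; last by lia.
rewrite add0r (_ : (m - (m - i) = i)%N); last by lia.
by rewrite inord_val.
Qed.

(** * Coefficient bounds from the location of the roots *)

(** Vieta's estimate, obtained by induction on [s]: multiplying by one more linear factor matches
    Pascal's rule for the bounds. *)
Lemma coef_prod_XsubC_le (R : numDomainType) (s : seq R) (r : R) (i : nat) :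
  {in s, forall z, `|z| <= r} ->
  `|(\prod_(z <- s) ('X - z%:P))`_i| <= 'C(size s, i)%:R * r ^+ (size s - i).
Proof.
elim: s i => [|z s IHs] i hs.
  by rewrite big_nil coef1 bin0n sub0n expr0 mulr1; case: i => [|i] /=;
    rewrite ?normr1 ?normr0.
have hz : `|z| <= r by apply: hs; rewrite inE eqxx.
have r0 : 0 <= r by apply: le_trans hz.
have {}IHs j : `|(\prod_(z <- s) ('X - z%:P))`_j| <= 'C(size s, j)%:R * r ^+ (size s - j).
  by apply: IHs => y ys; apply: hs; rewrite inE ys orbT.
rewrite big_cons mulrBl coefB coefXM coefCM.
case: i => [|i] /=.
  rewrite sub0r normrN normrM bin0 mul1r exprS ler_pM //.
  by apply: le_trans (IHs 0%N) _; rewrite bin0 mul1r subn0.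
apply: le_trans (ler_normB _ _) _.
rewrite binS subSS natrD mulrDl addrC lerD //.
rewrite normrM; apply: le_trans (ler_pM _ _ hz (IHs i.+1)) _ => //.
case: (ltnP i (size s)) => hi; last by rewrite bin_small ?ltnS // !mul0r mulr0.
by rewrite mulrCA -exprS -subSn.
Qed.

(** Split [p] into linear factors and remove one copy of [z0]. A second copy would make the square
    of ['X - z0%:P] divide [p], so every remaining root falls under the bound [r]. *)
Lemma simple_root_cofactor (R : numClosedFieldType) (p : {poly R}) (m : nat)
    (z0 r : R) :
  p \is monic -> size p = m.+2 -> mup z0 p = 1%N ->
  (forall z, root p z -> z != z0 -> `|z| <= r) ->
  exists2 q : {poly R}, p = ('X - z0%:P) * q &
    forall i, `|q`_i| <= 'C(m, i)%:R * r ^+ (m - i).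
Proof.
move=> pm sp mz hr.
have p0 : p != 0 by apply: monic_neq0.
have [s ps] := closed_field_poly_normal p.
move: ps; rewrite (monicP pm) scale1r => ps.
have rz : root p z0 by rewrite -dvdp_XsubCl XsubC_dvd ?mz.
have z0s : z0 \in s by rewrite -root_prod_XsubC -ps.
have ps' : p = ('X - z0%:P) * \prod_(z <- rem z0 s) ('X - z%:P).
  by rewrite ps (big_rem z0 z0s).
have q0 : \prod_(z <- rem z0 s) ('X - z%:P) != 0.
  by move: p0; rewrite ps' mulf_eq0 negb_or => /andP[].
have z0r : z0 \notin rem z0 s.
  rewrite -root_prod_XsubC; apply/negP => h.
  have : (1 < mup z0 p)%N; last by rewrite mz.
  by rewrite mup_geq // ps' expr2 dvdp_mul2l ?polyXsubC_eq0 // dvdp_XsubCl.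
exists (\prod_(z <- rem z0 s) ('X - z%:P)) => // i.
have -> : m = size (rem z0 s).
  by move: sp; rewrite ps size_prod_XsubC size_rem // => -[->].
apply: coef_prod_XsubC_le => z zs; apply: hr.
  by rewrite ps root_prod_XsubC (mem_rem zs).
by apply: contraNneq z0r => {1}<-.
Qed.

(** Compare coefficients in [('X - l) * q]. As [q] is monic of degree [m], the coefficient of ['X^m]
    gives [a ord0 + l] as the subleading coefficient of [q]; each later [a] combines two
    neighbouring coefficients of [q]. *)
Lemma bcnf_coef_le (R : realType) (m : nat) (a : 'I_m.+1 -> R) (l r : R) :
  simple_eigenvalue (bcnf_matrix a) l%:C ->
  other_eigenvalues_le (bcnf_matrix a) l%:C r ->
  `|a ord0 + l| <= m%:R * r /\
  forall k, (k < m)%N -> `|a (inord k.+1)| <=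
    `|l| * ('C(m, k.+1)%:R * r ^+ k.+1) + 'C(m, k.+2)%:R * r ^+ k.+2.
Proof.
move=> [ev ml] oth.
have normCR (x : R) : `|x%:C| = `|x|%:C.
  by rewrite normc_def /= expr0n addr0 sqrtr_sqr.
have [q pq hq] := @simple_root_cofactor _ _ m _ _
  (char_poly_monic (complexify (bcnf_matrix a))) (size_char_poly _) ml
  (fun z hz => oth z (eq_ind_r is_true hz (eigenvalue_root_char _ z))).
have cf i : (i <= m)%N ->
    (a (inord (m - i)))%:C = (if i is i'.+1 then q`_i' else 0) - l%:C * q`_i.
  move=> im; move: pq; rewrite /complexify -map_char_poly char_poly_bcnf.
  move=> /(congr1 (fun p : {poly R[i]} => p`_i)).
  rewrite coef_map mulrBl coefB coefXM coefCM coefD coefXn coef_poly /=.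
  rewrite [_ == _](_ : _ = false) ?ltnS ?im /= ?add0r; last by lia.
  by move=> ->; case: (i).
have lead : q`_m = 1.
  move: pq => /(congr1 (fun p : {poly R[i]} => p`_m.+1)).
  rewrite mulrBl coefB coefXM coefCM /=.
  have /monicP := char_poly_monic (complexify (bcnf_matrix a)).
  rewrite /lead_coef size_char_poly /= => ->.
  (* At index [m.+1] the bound [hq] carries a zero binomial, which forces this coefficient to
     vanish. *)
  have -> : q`_m.+1 = 0.
    by apply/eqP; rewrite -normr_le0 (le_trans (hq _)) // bin_small // mul0r.
  by rewrite mulr0 subr0.
split.
  have := cf m (leqnn m); rewrite subnn lead mulr1 => e.
  rewrite -lecR -normCR rmorphD /=.
  rewrite (_ : ord0 = inord 0); last by apply/val_inj; rewrite /= inordK.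
  rewrite e subrK; case: (m) hq => [|m'] hq.
    by rewrite normr0 mul0r.
  apply: le_trans (hq _) _.
  by rewrite subSnn expr1 binSn rmorphM /= rmorph_nat.
move=> k km.
have := cf (m - k.+1)%N (leq_subr _ _).
rewrite subKn // => e; rewrite -lecR -normCR e.
rewrite rmorphD !rmorphM /= !rmorphXn !rmorph_nat /= addrC -normCR.
apply: le_trans (ler_normD _ _) _; rewrite normrN normrM lerD //.
  apply: ler_wpM2l => //; apply: le_trans (hq _) _.
  by rewrite subKn // bin_sub.
(* Index 0 is the constant term, where the shifted coefficient of [q] is absent; there [k.+2]
   exceeds [m] and its bound is 0 as well. *)
case h : (m - k.+1)%N => [|j]; last first.
  apply: le_trans (hq _) _.
  have -> : j = (m - k.+2)%N by lia.
  by rewrite subKn ?bin_sub //; lia.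
by rewrite normr0 bin_small ?mul0r //; lia.
Qed.

(** * Numerical conditions and images of cone vectors *)

(** The third inequality serves contraction, the fourth expansion. With [nu = 1 + 2 * d] and
    denominators cleared, the hypotheses read [7 * (x * nu) < 6 * d] and
    [10 * (x * nu) < 1 - 2 * d]. *)
Lemma cone_numeric (R : realFieldType) (nu x : R) :
  1 < nu -> 0 < x ->
  x < 3 / 7 * (1 - 1 / nu) -> x < 1 / 10 * (2 / nu - 1) ->
  [/\ x < 1 / 10, x < (nu - 1) / 2,
     x * (nu + x / 2 + (nu - 1) / 2) < (nu - x - (nu - 1) / 2) * ((nu - 1) / 2)
   & 1 + ((nu - 1) / 2) ^+ 2 * (100 / 99) < (nu - x - (nu - 1) / 2) ^+ 2].
Proof.
move=> nu1 x0 h1 h2; set d := (nu - 1) / 2.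
have nuE : nu = 1 + 2 * d by rewrite /d; field.
have d0 : 0 < d by rewrite /d; lra.
have nu0 : 0 < nu by lra.
have {}h1 : 7 * (x * nu) < 6 * d.
  have := h1; rewrite -(ltr_pM2r nu0) => h.
  have e : 3 / 7 * (1 - 1 / nu) * nu = 3 / 7 * (nu - 1) by field; lra.
  by rewrite e in h; lra.
have {}h2 : 10 * (x * nu) < 1 - 2 * d.
  have := h2; rewrite -(ltr_pM2r nu0) => h.
  have e : 1 / 10 * (2 / nu - 1) * nu = 1 / 10 * (2 - nu) by field; lra.
  by rewrite e in h; lra.
have xx : x < x * nu by rewrite ltr_pMr.
clearbody d; subst nu.
have xd := mulr_gt0 x0 d0.
have x10 : x < 1 / 10 by lra.
split=> //.
- lra.
- have h1d : 7 * (x * (1 + 2 * d)) * (1 + 2 * d) < 6 * d * (1 + 2 * d).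
    by rewrite ltr_pM2r.
  nra.
- have hd : d < 1 / 2 by lra.
  case: (lerP d (1 / 4)) => h4; nra.
Qed.

Lemma bcnf_mul_col (R : realType) (m : nat) (a : 'I_m.+1 -> R) (mu : nat -> R)
    (i : 'I_m.+1) :
  (bcnf_matrix a *m
     \col_(j < m.+1) (if (j == 0 :> nat)%N then 1 else mu j)) i 0
  = - a i + (if (i < m)%N then mu i.+1 else 0).
Proof.
rewrite mxE big_ord_recl !mxE /= mulr1; congr (_ + _).
case: ltnP => him.
  rewrite (bigD1 (Ordinal him)) //= !mxE /= /bump /= add1n eqxx mul1r.
  rewrite big1 ?addr0 // => j ji; rewrite !mxE /= /bump /= add1n eqSS.
  case: eqP => [e|_]; last by rewrite mul0r.
  by case/eqP: ji; apply: val_inj.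
rewrite big1 // => j _; rewrite !mxE /= /bump /= add1n eqSS.
case: eqP => [e|_]; last by rewrite mul0r.
by have := ltn_ord j; rewrite e ltnNge him.
Qed.

Lemma bin_succ_le (R : realFieldType) (m k : nat) :
  k.+1%:R * 'C(m, k.+1)%:R <= m%:R * 'C(m, k)%:R :> R.
Proof. by rewrite -!natrM mul_bin_left ler_nat leq_mul2r leq_subr orbT. Qed.

Lemma bin_le_exp (m k : nat) : ('C(m, k) <= m ^ k)%N.
Proof.
elim: k => [|k IHk]; first by rewrite bin0.
rewrite expnS; apply: leq_trans (leq_mul (leqnn m) IHk).
have : (k.+1 * 'C(m, k.+1) <= m * 'C(m, k))%N.
  by rewrite mul_bin_left leq_mul2r leq_subr orbT.
by apply: leq_trans; rewrite leq_pmull.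
Qed.

(** The first entry differs from [l] by at most [x + d]. With [B], [B1], [B2] the successive terms
    of binomial times power of [r], a later entry is at most [|l| * B1 + B2 + d * B1], and both [B1]
    and [B2] are controlled by [B]. *)
Lemma bcnf_cone_bounds (R : realType) (m : nat) (a : 'I_m.+1 -> R)
    (l r nu : R) (mu : nat -> R) (d := (nu - 1) / 2) (x := r * m%:R)
    (u := bcnf_matrix a *m
       \col_(j < m.+1) (if (j == 0 :> nat)%N then 1 else mu j)) :
  (0 < m)%N -> 0 < r -> 1 < nu -> nu <= `|l| ->
  simple_eigenvalue (bcnf_matrix a) l%:C ->
  other_eigenvalues_le (bcnf_matrix a) l%:C r ->
  x < d -> x * (nu + x / 2 + d) < (nu - x - d) * d ->
  (forall k, (k < m)%N -> `|mu k.+1| <= d * 'C(m, k)%:R * r ^+ k) ->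
  nu - x - d <= `|u ord0 0| /\
  forall k, (k < m)%N ->
    `|u (inord k.+1) 0| < `|u ord0 0| * (d * 'C(m, k)%:R * r ^+ k).
Proof.
move=> m0 r0 nu1 lnu ev oth xd hx hmu.
have [a0 ha] := bcnf_coef_le ev oth.
have d0 : 0 < d by rewrite /d; lra.
have first_entry : `|l| - x - d <= `|u ord0 0|.
  have mu1 : `|mu 1%N| <= d by have := hmu 0%N m0; rewrite bin0 expr0 !mulr1.
  rewrite /u bcnf_mul_col /= m0.
  have -> : - a ord0 + mu 1%N = l - ((a ord0 + l) - mu 1%N) by ring.
  apply: le_trans (lerB_dist _ _).
  have := ler_normB (a ord0 + l) (mu 1%N).
  rewrite /x; lra.
split=> [|k km]; first lra.
set B : R := 'C(m, k)%:R * r ^+ k.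
have B0 : 0 < B by rewrite mulr_gt0 ?exprn_gt0 // ltr0n bin_gt0 ltnW.
set B1 : R := 'C(m, k.+1)%:R * r ^+ k.+1.
set B2 : R := 'C(m, k.+2)%:R * r ^+ k.+2.
have B10 : 0 <= B1 by rewrite mulr_ge0 ?exprn_ge0 // ltW.
have x0 : 0 < x by rewrite mulr_gt0 ?ltr0n.
(* The factor [j.+1] is kept on the left because it yields the gain [x / 2] in [s2]. *)
have step j : j.+1%:R * ('C(m, j.+1)%:R * r ^+ j.+1) <=
    x * ('C(m, j)%:R * r ^+ j) :> R.
  have := bin_succ_le R m j.
  rewrite -(ler_pM2r (exprn_gt0 j.+1 r0)) => h.
  rewrite mulrA; apply: le_trans h _.
  by rewrite le_eqVlt; apply/orP; left; apply/eqP; rewrite /x exprS; ring.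
have s1 : B1 <= x * B.
  by apply: le_trans (step k); rewrite -/B1 ler_peMl // ler1n.
have s2 : B2 <= x / 2 * B1.
  have := step k.+1; rewrite -/B1 -/B2 => h.
  have B20 : 0 <= B2 by rewrite mulr_ge0 ?exprn_ge0 // ltW.
  have : 2 * B2 <= k.+2%:R * B2 by rewrite ler_wpM2r // ler_nat.
  lra.
have U : `|u (inord k.+1) 0| <= `|l| * B1 + B2 + d * B1.
  rewrite /u bcnf_mul_col inordK ?ltnS //.
  apply: le_trans (ler_normD _ _) _; rewrite normrN lerD ?ha //.
  case: ltnP => h; first by rewrite /B1 mulrA hmu.
  by rewrite normr0 mulr_ge0 // ltW.
have l1 : 0 < `|l| + x / 2 + d by lra.
have U' : `|u (inord k.+1) 0| <= (`|l| + x / 2 + d) * (x * B).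
  apply: le_trans U _; apply: le_trans (ler_wpM2l (ltW l1) s1); lra.
(* [hx] is the case of modulus [nu]. Increasing the modulus by [t] adds [x * t] on the left and
   [d * t] on the right, and [x < d]. *)
have l2 : x * (`|l| + x / 2 + d) < (`|l| - x - d) * d by nra.
rewrite -mulrA -/B mulrA; apply: le_lt_trans U' _.
rewrite mulrA ltr_pM2r // mulrC; apply: lt_le_trans l2 _.
by rewrite ler_wpM2r // ltW.
Qed.

(** * Interior of the cone *)

(** Finitely many strict inequalities between continuous functions persist near [u]. The one at
    [k = 0] also forces a nonzero first entry, so nearby vectors can be divided by it to exhibit the
    parameters of the cone. *)
Lemma interior_conePsi (R : realType) (m : nat) (alpha beta r : R)
    (u : 'cV[R]_m.+1) :
  (0 < m)%N ->
  (forall k, (k < m)%N ->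
     `|u (inord k.+1) 0| <
     `|u ord0 0| * (coneN m.+1 alpha beta k.+1 * r ^+ k)) ->
  interior (@conePsi R m.+1 alpha beta r) u.
Proof.
move=> m0 hu; rewrite /interior /=.
pose f (k : 'I_m) (w : 'cV[R]_m.+1) : R :=
  `|w (inord k.+1) 0| - `|w ord0 0| * (coneN m.+1 alpha beta k.+1 * r ^+ k).
have near_f k : nbhs u [set w | f k w < 0].
  have cont_norm i : `|w i 0| @[w --> u] --> `|u i 0|.
    by apply: cvg_norm; apply: coord_continuous.
  have cont : f k w @[w --> u] --> f k u.
    exact: cvgB (cont_norm _) (cvgMr_tmp (cont_norm _)).
  by apply: (cvgr_lt _ cont); rewrite subr_lt0; apply: hu.
apply: filterS (@filter_forall _ _ (fun k w => is_true (f k w < 0)) (nbhs u) _ near_f).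
move=> w hw.
have {}hw k : (k < m)%N -> `|w (inord k.+1) 0| <
    `|w ord0 0| * (coneN m.+1 alpha beta k.+1 * r ^+ k).
  by move=> km; have := hw (Ordinal km); rewrite subr_lt0.
have w0 : w ord0 0 != 0.
  apply/negP => /eqP e; have := hw 0%N m0.
  by rewrite e normr0 mul0r ltNge normr_ge0.
exists (w ord0 0), (fun i => w (inord i) 0 / w ord0 0); split.
  case=> // k /= km; rewrite normrM normfV ler_pdivrMr ?normr_gt0 //.
  by rewrite mulrC ltW // hw.
apply/matrixP => i j; rewrite !mxE (ord1 j); case: eqP => [e|_].
  by rewrite mulr1; congr (w _ _); apply: val_inj.
by rewrite inord_val mulrC divfK.
Qed.

(** * Euclidean norm on the cone *)

Lemma eucl_normZ (R : realType) (n : nat) (t : R) (v : 'cV[R]_n) :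
  eucl_norm (t *: v) = `|t| * eucl_norm v.
Proof.
rewrite /eucl_norm -sqrtr_sqr -sqrtrM ?sqr_ge0 //; congr Num.sqrt.
by rewrite mulr_sumr; apply: eq_bigr => i _; rewrite mxE exprMn.
Qed.

Lemma normr_le_eucl_norm (R : realType) (n : nat) (v : 'cV[R]_n) (i : 'I_n) :
  `|v i 0| <= eucl_norm v.
Proof.
rewrite /eucl_norm -sqrtr_sqr ler_wsqrtr // (bigD1 i) //= lerDl.
by apply: sumr_ge0 => j _; apply: sqr_ge0.
Qed.

Lemma sum_expr_le (R : realFieldType) (y : R) (m : nat) :
  0 <= y -> y < 1 -> \sum_(k < m) y ^+ k <= (1 - y)^-1.
Proof.
move=> y0 y1; rewrite -[leRHS]mul1r ler_pdivlMr ?subr_gt0 //.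
rewrite -[1 - y]opprB mulrN mulrC -subrX1 opprB gerBl.
exact: exprn_ge0.
Qed.

(** Since ['C(m, k) <= m ^ k], the entries after the first are at most [d * x ^+ k]. Their squares
    are dominated by a geometric series of ratio below [1 / 100], whence the factor [100 / 99]. *)
Lemma eucl_norm_cone_le (R : realType) (m : nat) (d r : R) (mu : nat -> R)
    (x := r * m%:R) :
  0 <= r -> 0 <= d -> x < 1 / 10 ->
  (forall k, (k < m)%N -> `|mu k.+1| <= d * 'C(m, k)%:R * r ^+ k) ->
  eucl_norm (\col_(j < m.+1) (if (j == 0 :> nat)%N then 1 else mu j))
  <= Num.sqrt (1 + d ^+ 2 * (100 / 99)).
Proof.
move=> r0 d0 x1 hmu; rewrite /eucl_norm ler_wsqrtr //.
have x0 : 0 <= x by rewrite mulr_ge0.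
rewrite big_ord_recl mxE /= expr1n lerD2l.
apply: (@le_trans _ _ (\sum_(k < m) d ^+ 2 * (x ^+ 2) ^+ k)).
  apply: ler_sum => k _; rewrite mxE /= /bump /= add1n.
  rewrite -exprM mulnC exprM -exprMn -real_normK ?num_real //.
  rewrite lerXn2r ?nnegrE ?mulr_ge0 ?exprn_ge0 //.
  apply: le_trans (hmu k (ltn_ord k)) _.
  rewrite -mulrA ler_wpM2l // /x exprMn mulrC ler_wpM2l ?exprn_ge0 //.
  by rewrite -natrX ler_nat bin_le_exp.
rewrite -mulr_sumr ler_wpM2l ?sqr_ge0 //.
have x2 : x ^+ 2 < 1 / 100 by nra.
apply: le_trans (sum_expr_le _ _ _) _; [exact: sqr_ge0|lra|].
rewrite -[leLHS]mul1r ler_pdivrMr; lra.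
Qed.

Theorem proposition3p2 (R : realType) (n : nat) (aL aR : 'I_n -> R)
    (alpha beta r : R) :
  (2 <= n)%N ->
  1 < alpha -> simple_eigenvalue (bcnf_matrix aL) alpha%:C ->
  - beta < -1 -> simple_eigenvalue (bcnf_matrix aR) (- beta)%:C ->
  0 < r -> r < 1 ->
  other_eigenvalues_le (bcnf_matrix aL) alpha%:C r ->
  other_eigenvalues_le (bcnf_matrix aR) (- beta)%:C r ->
  r * (n%:R - 1) < 3 / 7 * (1 - 1 / alpha) ->
  r * (n%:R - 1) < 3 / 7 * (1 - 1 / beta) ->
  r * (n%:R - 1) < 1 / 10 * (1 / alpha + 1 / beta - 1) ->
  contracting_invariant [set bcnf_matrix aL; bcnf_matrix aR]
    (@conePsi R n alpha beta r) /\
  expanding [set bcnf_matrix aL; bcnf_matrix aR] (@conePsi R n alpha beta r).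
Proof.
case: n aL aR => [//|m] aL aR; rewrite ltnS -natr1 addrK => m0.
move=> al1 evL be1' evR r0 r1 othL othR hal hbe hab.
have be1 : 1 < beta by lra.
set nu := Num.min alpha beta.
have nu1 : 1 < nu by rewrite lt_min al1.
have nual : nu <= alpha by rewrite ge_min lexx.
have nube : nu <= beta by rewrite ge_min lexx orbT.
have hnu : r * m%:R < 3 / 7 * (1 - 1 / nu) by rewrite /nu minEle; case: ifP.
(* Both reciprocals are at most [1 / nu], so the third hypothesis becomes a condition on [nu]
   alone. *)
have hnu2 : r * m%:R < 1 / 10 * (2 / nu - 1).
  have : 1 / alpha <= 1 / nu by rewrite ler_pM2l // lef_pV2 ?posrE; lra.
  have : 1 / beta <= 1 / nu by rewrite ler_pM2l // lef_pV2 ?posrE; lra.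
  lra.
have x0 : 0 < r * m%:R by rewrite mulr_gt0 // ltr0n.
have [hx10 hxd hcon hexp] := cone_numeric nu1 x0 hnu hnu2.
have bounds A : [set bcnf_matrix aL; bcnf_matrix aR] A -> forall mu : nat -> R,
    (forall k, (k < m)%N ->
       `|mu k.+1| <= (nu - 1) / 2 * 'C(m, k)%:R * r ^+ k) ->
    let u := A *m \col_(j < m.+1) (if (j == 0 :> nat)%N then 1 else mu j) in
    nu - r * m%:R - (nu - 1) / 2 <= `|u ord0 0| /\
    forall k, (k < m)%N -> `|u (inord k.+1) 0| <
      `|u ord0 0| * ((nu - 1) / 2 * 'C(m, k)%:R * r ^+ k).
  case=> -> mu hmu; [apply: bcnf_cone_bounds evL othL _ _ _ |
    apply: bcnf_cone_bounds evR othR _ _ _] => //.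
  - by rewrite (le_trans nual) // ler_norm.
  - by rewrite normrN (le_trans nube) // ler_norm.
split.
  move=> A v UA [g [mu [hmu ->]]]; rewrite -scalemxAr.
  (* The multiplier [g = 0] gives the apex; otherwise the strict bounds are homogeneous and reduce
     to first entry 1. *)
  have [->|g0] := eqVneq g 0; first by right; rewrite scale0r.
  have [|_ hu] := bounds A UA mu.
    by move=> k km; apply: (hmu k.+1).
  left; apply: interior_conePsi => // k km.
  rewrite [X in `|X| < _]mxE [X in _ < `|X| * _]mxE !normrM -mulrA.
  by rewrite ltr_pM2l ?normr_gt0 //; apply: hu.
set K := Num.sqrt (1 + ((nu - 1) / 2) ^+ 2 * (100 / 99)).
have d2 : 0 <= ((nu - 1) / 2) ^+ 2 by apply: sqr_ge0.
have K0 : 0 < K by rewrite sqrtr_gt0; lra.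
have KF : K < nu - r * m%:R - (nu - 1) / 2.
  have F0 : 0 <= nu - r * m%:R - (nu - 1) / 2 by lra.
  rewrite -(ger0_norm F0) -sqrtr_sqr ltr_sqrt //.
  by apply: le_lt_trans hexp; lra.
(* For cone vectors with first entry 1, the numerator bounds the first entry of the image from
   below, hence its norm, and [K] bounds the norm of the vector from above. *)
exists ((nu - r * m%:R - (nu - 1) / 2) / K).
  by rewrite ltr_pdivlMr // mul1r.
move=> A v UA [g [mu [hmu ->]]]; rewrite -scalemxAr !eucl_normZ mulrCA.
apply: ler_wpM2l => //.
have {}hmu k : (k < m)%N -> `|mu k.+1| <= (nu - 1) / 2 * 'C(m, k)%:R * r ^+ k.
  by move=> km; apply: (hmu k.+1).
have [hu _] := bounds A UA mu hmu.
apply: le_trans (normr_le_eucl_norm _ ord0); apply: le_trans hu.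
have d0 : 0 <= (nu - 1) / 2 by lra.
rewrite mulrAC ler_pdivrMr //; apply: ler_wpM2l; first lra.
exact: eucl_norm_cone_le (ltW r0) d0 hx10 hmu.
Qed.
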